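(* For any $f\in\mathcal{A}\setminus\mathcal{S}$ and any sequence $(\alpha_i)_{i\ge0}$ of complex numbers with distinct real parts, the set of arithmetic functions $$\operatorname{Exp}^*\{T^{\alpha_i}\partial_L^j f: i,j\ge 0\}$$ is algebraically independent over the kernel of any infinite subset of $\Delta_f$ and consequently over $\mathcal{S}$.
   Context: $\mathbb{N}=\{1,2,3,\dots\}$. An arithmetic function is a function $f:\mathbb{N}\to\mathbb{C}$. $\mathcal{A}$ is the commutative $\mathbb{C}$-algebra (an integral domain) of arithmetic functions under pointwise addition and convolution $(f*g)(n)=\sum_{d\mid n}f(d)g(n/d)$; $\alpha\in\mathbb{C}$ is identified with the function $1\mapsto\alpha$, $n\mapsto 0$ for $n>1$. Algebraic independence refers to this ring. For $\alpha\in\mathbb{C}$, $T^\alpha:\mathcal{A}\to\mathcal{A}$ is $(T^\alpha f)(n)=n^\alpha f(n)$. $\partial_L$ is the log-derivation $(\partial_Lf)(n)=\log(n)f(n)$, and $\partial_L^j$ its $j$-th iterate ($\partial_L^0=\mathrm{id}$). $\operatorname{supp} f=\{n:f(n)\ne0\}$; for $A\subseteq\mathbb{N}$, $[A]$ is the set of primes dividing some member of $A$. $\mathcal{S}$ is the subalgebra of all $f\in\mathcal{A}$ with $[\operatorname{supp} f]$ finite. For a prime $p$, $\partial_p$ is the derivation of $\mathcal{A}$ given by $(\partial_pf)(n)=v_p(np)f(np)$, where $v_p(m)$ is the exponent of $p$ in $m$. $\Delta_f=\{\partial_p:p\in[\operatorname{supp} f]\}$. The kernel of a set $\Delta$ of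 derivations is $\{x\in\mathcal{A}:Dx=0\ \forall D\in\Delta\}$. For $f\ne 0$ let $v(f)$ be the least element of $\operatorname{supp} f$, and $v(0)=\infty$; $\|f\|=1/v(f)$ is a non-archimedean norm giving a topology on $\mathcal{A}$. If $f(1)=0$, $\operatorname{Exp}(f)=\sum_{k\ge0}f^k/k!$ (convolution powers; convergent in this topology); in general $\operatorname{Exp}(f)=\exp(f(1))*\operatorname{Exp}(f-f(1))$. Let $\mathcal{A}_{\mathbb{R}}=\{f:f(1)\in\mathbb{R}\}$ and $\mathcal{A}_+=\{f:f(1)\in\mathbb{R},\,f(1)>0\}$. $\operatorname{Exp}$ restricts to a group isomorphism $(\mathcal{A}_{\mathbb{R}},+)\to(\mathcal{A}_+,* )$ with inverse $\operatorname{Log}$. $\operatorname{Exp}^m$ denotes $m$-fold composition for $m\ge 0$, and $\operatorname{Exp}^{-k}=\operatorname{Log}^k$ (where defined) for $k\ge1$. For each $f\in\mathcal{A}$ there is a largest $k\ge0$ such that $\operatorname{Log}^kf$ is defined. For nonempty $W\subseteq\mathcal{A}$, $k_W$ is the largest $k\ge0$ such that $\operatorname{Log}^{k}f$ is defined for every $f\in W$, and $\operatorname{Exp}^*W=\{\operatorname{Exp}^mf: f\in W,\ m\in\mathbb{Z},\ m\ge -k_W\}$. *)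

(* Defs.v *)
From HB Require Import structures.
From mathcomp Require Import all_boot all_order all_algebra.
From mathcomp Require Import all_classical all_reals all_analysis.
From mathcomp Require Import complex.
(* The notations of [mpoly] clash with those of MathComp-Analysis. *)
From mathcomp Require Import -(notations) mpoly.

Set Implicit Arguments.
Unset Strict Implicit.
Unset Printing Implicit Defensive.

Import Order.TTheory GRing.Theory Num.Theory.

Local Open Scope classical_set_scope.
Local Open Scope complex_scope.
Local Open Scope ring_scope.

(* A function on the positive integers is encoded as a function on [nat] that
   vanishes at 0. *)
Record arith (R : realType) := Arith {
  afun :> nat -> R[i];
  _ : afun 0%N = 0 }.

Section ArithRing.
Variable R : realType.
Implicit Types (f g h : arith R) (n N : nat).

Lemma arith0 f : f 0%N = 0. Proof. by case: f. Qed.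

Lemma arithP f g : (forall n, (0 < n)%N -> f n = g n) -> f = g.
Proof.
move=> fg; have {fg} : afun f = afun g.
  by apply/funext => -[|n]; rewrite ?arith0// fg.
case: f g => [f f0] [g g0] /= fg; case: _ / fg g0 => g0.
by congr Arith; exact: Prop_irrelevance.
Qed.

HB.instance Definition _ := gen_eqMixin (arith R).
HB.instance Definition _ := gen_choiceMixin (arith R).

Definition mk_arith (u : nat -> R[i]) : arith R :=
  @Arith R (fun n => if n == 0%N then 0 else u n) erefl.

Lemma mk_arithE u n : (0 < n)%N -> mk_arith u n = u n.
Proof. by case: n. Qed.

Definition arith_zero : arith R := mk_arith (fun=> 0).
Definition arith_opp f : arith R := mk_arith (fun n => - f n).
Definition arith_add f g : arith R := mk_arith (fun n => f n + g n).

Fact arith_addA : associative arith_add.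
Proof. by move=> f g h; apply: arithP => n n0; rewrite !mk_arithE// addrA. Qed.

Fact arith_addC : commutative arith_add.
Proof. by move=> f g; apply: arithP => n n0; rewrite !mk_arithE// addrC. Qed.

Fact arith_add0 : left_id arith_zero arith_add.
Proof. by move=> f; apply: arithP => n n0; rewrite !mk_arithE// add0r. Qed.

Fact arith_addN : left_inverse arith_zero arith_opp arith_add.
Proof. by move=> f; apply: arithP => n n0; rewrite !mk_arithE// addNr. Qed.

HB.instance Definition _ := GRing.isZmodule.Build (arith R)
  arith_addA arith_addC arith_add0 arith_addN.

Lemma arith0E n : (0 : arith R) n = 0.
Proof. by case: n. Qed.

Lemma arithDE f g n : (f + g) n = f n + g n.
Proof. by case: n => [|n]; rewrite ?arith0 ?addr0. Qed.

Lemma arithNE f n : (- f) n = - f n.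
Proof. by case: n => [|n]; rewrite ?arith0 ?oppr0. Qed.

Definition conv f g : arith R :=
  mk_arith (fun n => \sum_(d <- divisors n) f d * g (n %/ d)%N).

Definition arith_one : arith R := mk_arith (fun n => (n == 1%N)%:R).

Lemma convE f g n N : (0 < n <= N)%N ->
  conv f g n = \sum_(i < N.+1) \sum_(j < N.+1 | (i * j == n)%N) f i * g j.
Proof.
move=> /andP[n0 nN]; rewrite mk_arithE//.
have inner (i : 'I_N.+1) : \sum_(j < N.+1 | (i * j == n)%N) f i * g j =
    if (i %| n)%N then f i * g (n %/ i)%N else 0.
  case: ifPn => [din|ndin]; last first.
    rewrite big1// => j /eqP ijn; move: ndin.
    by rewrite -ijn dvdn_mulr.
  have i0 : (0 < i)%N by apply: dvdn_gt0 din.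
  have qN : (n %/ i < N.+1)%N by rewrite ltnS (leq_trans (leq_div _ _)).
  rewrite (big_pred1 (Ordinal qN))// => j /=.
  by rewrite -val_eqE/= eqn_div// mulnC.
rewrite [RHS](eq_bigr _ (fun i _ => inner i)).
rewrite -big_mkcond/= -(big_mkord (fun i => i %| n)%N
  (fun i => f i * g (n %/ i)%N)) -[RHS]big_filter.
apply: perm_big; apply: uniq_perm; first exact: divisors_uniq.
  by rewrite filter_uniq// iota_uniq.
move=> d; rewrite mem_filter mem_index_iota -dvdn_divisors//=.
case dn: (d %| n)%N => //=.
by rewrite ltnS (leq_trans (dvdn_leq n0 dn) nN).
Qed.

Fact conv_comm : commutative conv.
Proof.
move=> f g; apply: arithP => n n0.
rewrite !(@convE _ _ n n) ?n0 ?leqnn//.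
rewrite (exchange_big_dep predT)//=; apply: eq_bigr => i _.
by apply: eq_big => [j|j _]; rewrite ?(mulnC i j)// mulrC.
Qed.

Fact conv_one : left_id arith_one conv.
Proof.
move=> f; apply: arithP => n n0; rewrite mk_arithE//.
rewrite (bigD1_seq 1%N) ?divisors_uniq -?dvdn_divisors//=.
rewrite mul1r divn1 big_seq_cond big1 ?addr0// => d.
rewrite -dvdn_divisors// => /andP[dn /negPf d1].
by rewrite d1 if_same mul0r.
Qed.

Fact convDl : left_distributive conv +%R.
Proof.
move=> f g h; apply: arithP => n n0.
rewrite arithDE /conv !mk_arithE// -big_split.
by apply: eq_bigr => d _; rewrite arithDE mulrDl.
Qed.

Lemma conv_triple f g h n : (0 < n)%N -> conv (conv f g) h n =
  \sum_(i < n.+1) \sum_(j < n.+1) \sum_(k < n.+1)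
    if (i * j * k == n)%N then f i * g j * h k else 0.
Proof.
move=> n0; rewrite (@convE _ _ n n) ?n0 ?leqnn//.
transitivity (\sum_(d < n.+1) \sum_(i < n.+1) \sum_(j < n.+1)
    \sum_(k < n.+1 | ((d * k == n) && (i * j == d))%N) f i * g j * h k).
  apply: eq_bigr => d _.
  case: (posnP d) => [->|d0].
    rewrite big1; last by move=> k; rewrite mul0n eq_sym (gtn_eqF n0).
    rewrite big1// => i _; rewrite big1// => j _; rewrite big1// => k.
    by rewrite mul0n eq_sym (gtn_eqF n0).
  transitivity (\sum_(k < n.+1 | (d * k == n)%N) \sum_(i < n.+1)
      \sum_(j < n.+1 | (i * j == d)%N) f i * g j * h k).
    apply: eq_bigr => k _; rewrite (@convE _ _ d n); last first.
      by rewrite d0 -ltnS ltn_ord.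
    by rewrite mulr_suml; apply: eq_bigr => i _; rewrite mulr_suml.
  rewrite exchange_big/=; apply: eq_bigr => i _.
  by rewrite (exchange_big_dep predT).
rewrite exchange_big/=; apply: eq_bigr => i _.
rewrite exchange_big/=; apply: eq_bigr => j _.
rewrite (exchange_big_dep predT)//=.
apply: eq_bigr => k _; case: ifPn => [/eqP ijkn|nijk].
  have ijn : (i * j < n.+1)%N.
    have : (0 < i * j * k)%N by rewrite ijkn.
    rewrite muln_gt0 => /andP[_ k0].
    by rewrite ltnS (leq_trans _ (eq_leq ijkn))// leq_pmulr.
  rewrite (big_pred1 (Ordinal ijn))// => d /=; rewrite -val_eqE/= [RHS]eq_sym.
  by rewrite andbC; case: eqP => //= <-; rewrite ijkn eqxx.
rewrite big1// => d /andP[/eqP dkn /eqP ijd]; move: nijk.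
by rewrite ijd dkn eqxx.
Qed.

Fact conv_assoc : associative conv.
Proof.
move=> f g h; rewrite [LHS]conv_comm; apply: arithP => n n0.
rewrite !conv_triple//.
under eq_bigr do rewrite exchange_big/=.
rewrite exchange_big/=; apply: eq_bigr => i _; apply: eq_bigr => j _.
apply: eq_bigr => k _.
by rewrite (mulnC (j * k)%N) mulnA (mulrC (g j * h k)) mulrA.
Qed.

Fact arith_one_neq0 : arith_one != 0.
Proof.
apply/eqP => /(congr1 (fun f : arith R => f 1%N)).
by rewrite mk_arithE// arith0E => /eqP; rewrite oner_eq0.
Qed.

HB.instance Definition _ := GRing.Zmodule_isComNzRing.Build (arith R)
  conv_assoc conv_comm conv_one convDl arith_one_neq0.

Definition arith_scale (a : R[i]) f : arith R := mk_arith (fun n => a * f n).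

Fact arith_scaleA a b f : arith_scale a (arith_scale b f) = arith_scale (a * b) f.
Proof. by apply: arithP => n n0; rewrite !mk_arithE// mulrA. Qed.

Fact arith_scale1 : left_id 1 arith_scale.
Proof. by move=> f; apply: arithP => n n0; rewrite !mk_arithE// mul1r. Qed.

Fact arith_scaleDr : right_distributive arith_scale +%R.
Proof.
move=> a f g; apply: arithP => n n0.
by rewrite arithDE !mk_arithE// mulrDr.
Qed.

Fact arith_scaleDl f a b :
  arith_scale (a + b) f = arith_scale a f + arith_scale b f.
Proof.
apply: arithP => n n0.
by rewrite arithDE !mk_arithE// mulrDl.
Qed.

HB.instance Definition _ := GRing.Zmodule_isLmodule.Build R[i] (arith R)
  arith_scaleA arith_scale1 arith_scaleDr arith_scaleDl.

Fact arith_scaleAl (a : R[i]) (f g : arith R) : a *: (f * g) = (a *: f) * g.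
Proof.
apply: arithP => n n0; rewrite !mk_arithE// mulr_sumr big_seq [RHS]big_seq.
apply: eq_bigr => d; rewrite -dvdn_divisors// => dn.
by rewrite mk_arithE ?mulrA// (dvdn_gt0 n0 dn).
Qed.

(* The identification of a complex number [a] with an arithmetic function is
   [a%:A], that is [a *: 1]. *)
HB.instance Definition _ :=
  GRing.Lmodule_isLalgebra.Build R[i] (arith R) arith_scaleAl.
HB.instance Definition _ :=
  GRing.Lalgebra_isComAlgebra.Build R[i] (arith R).

Definition supp f : set nat := [set n | f n != 0].

Definition primes_of (A : set nat) : set nat :=
  [set p | prime p /\ exists2 n, A n & (p %| n)%N].

(* [v 0] is infinite; here [vmin 0 = 0], and [anorm] sets the norm of 0 apart. *)
Definition vmin f : nat :=
  xget 0%N [set n | supp f n /\ forall m, supp f m -> (n <= m)%N].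

Definition anorm f : R := if f == 0 then 0 else (vmin f)%:R^-1.

Lemma vminP f : f != 0 ->
  supp f (vmin f) /\ forall m, supp f m -> (vmin f <= m)%N.
Proof.
move=> f0; have [n fn] : exists n, f n != 0.
  apply: contrapT => f_eq0; move/eqP: f0; apply; apply: arithP => n _.
  by rewrite arith0E; apply/eqP/negPn/negP => fn; apply: f_eq0; exists n.
have exf : exists n, (fun n => f n != 0) n by exists n.
rewrite /vmin; case: xgetP => [x _ //|/(_ (ex_minn exf))].
by case: ex_minnP => m fm min_m []; split.
Qed.

Lemma anorm0 : anorm 0 = 0.
Proof. by rewrite /anorm eqxx. Qed.

Lemma anorm_gt0 f : f != 0 -> 0 < anorm f.
Proof.
move=> f0; rewrite /anorm (negPf f0) invr_gt0 ltr0n.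
have [] := vminP f0; rewrite /supp/=.
by case: (vmin f) => //; rewrite arith0 eqxx.
Qed.

Lemma anorm_ge0 f : 0 <= anorm f.
Proof. by have [->|/anorm_gt0/ltW//] := eqVneq f 0; rewrite anorm0. Qed.

Lemma anorm_ge f n : f n != 0 -> n%:R^-1 <= anorm f.
Proof.
move=> fn; have f0 : f != 0.
  by apply: contra_neq fn => ->; rewrite arith0E.
have [fv minv] := vminP f0.
have := anorm_gt0 f0; rewrite /anorm (negPf f0) => v0.
have {}v0 : 0 < (vmin f)%:R :> R by rewrite -invr_gt0.
rewrite lef_pV2 ?posrE// ?ler_nat ?minv//.
by rewrite (lt_le_trans v0)// ler_nat minv.
Qed.

Lemma anormN f : anorm (- f) = anorm f.
Proof.
have suppN : supp (- f) = supp f.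
  by apply/funext => n; rewrite /supp /mkset arithNE oppr_eq0.
by rewrite /anorm oppr_eq0 /vmin suppN.
Qed.

Lemma anormD f g : anorm (f + g) <= Num.max (anorm f) (anorm g).
Proof.
have [->|fg0] := eqVneq (f + g) 0; first by rewrite anorm0 le_max anorm_ge0.
have [fgv _] := vminP fg0.
rewrite {1}/anorm (negPf fg0) le_max.
have [fv|/anorm_ge -> //] := eqVneq (f (vmin (f + g))) 0.
rewrite [X in _ || X]anorm_ge ?orbT//.
by move: fgv; rewrite /supp /mkset arithDE fv add0r.
Qed.

Definition adist f g : R := anorm (f - g).

Fact adistxx f : adist f f = 0.
Proof. by rewrite /adist subrr anorm0. Qed.

Fact adist_positivity f g : adist f g = 0 -> f = g.
Proof.
move=> fg; apply/eqP; rewrite -subr_eq0.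
by apply: contra_eqT fg => /anorm_gt0/gt_eqF->.
Qed.

Fact adist_sym f g : adist f g = adist g f.
Proof. by rewrite /adist -opprB anormN. Qed.

Fact adist_triangle g f h : adist f h <= adist f g + adist g h.
Proof.
rewrite /adist -(subrKA g) (le_trans (anormD _ _))// ge_max.
by rewrite lerDl lerDr !anorm_ge0.
Qed.

HB.instance Definition _ := isPointed.Build (arith R) 0.
HB.instance Definition _ := isMetric.Build R (arith R)
  adistxx adist_positivity adist_sym adist_triangle.

End ArithRing.

Section LogExp.
Variable R : realType.
Implicit Types (f g h : arith R) (W X K : set (arith R)).

Definition cexp (z : R[i]) : R[i] :=
  (expR (complex.Re z) * cos (complex.Im z)) +i*
  (expR (complex.Re z) * sin (complex.Im z)).

Definition Tpow (a : R[i]) f : arith R :=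
  mk_arith (fun n => cexp (a * (ln n%:R)%:C) * f n).

Definition dlog f : arith R := mk_arith (fun n => (ln n%:R)%:C * f n).

Definition dprime (p : nat) f : arith R :=
  mk_arith (fun n => (logn p (n * p))%:R * f (n * p)%N).

Definition Delta f : set (arith R -> arith R) := dprime @` primes_of (supp f).

Definition ker_der (D : set (arith R -> arith R)) : set (arith R) :=
  [set x | forall d, D d -> d x = 0].

Definition Sfin : set (arith R) := [set f | finite_set (primes_of (supp f))].

(* The limit is taken in the metric topology of [anorm]. *)
Definition Exp f : arith R :=
  (cexp (f 1%N))%:A *
  limn (series (fun k => k`!%:R^-1 *: (f - (f 1%N)%:A) ^+ k)).

Definition A_real : set (arith R) := [set f | complex.Im (f 1%N) = 0].

Definition A_pos : set (arith R) :=
  [set f | complex.Im (f 1%N) = 0 /\ 0 < complex.Re (f 1%N)].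

(* The inverse of [Exp : A_real -> A_pos]; a default value outside [A_pos]. *)
Definition Log f : arith R := xget 0 [set g | A_real g /\ Exp g = f].

(* [Log^k f] is defined when [Log] is applied only to elements of [A_pos]. *)
Definition Log_iter_defined (k : nat) f : Prop :=
  forall i, (i < k)%N -> A_pos (iter i Log f).

(* The maximum exists when [W] is nonempty. *)
Definition kW W : nat :=
  xget 0%N [set k | (forall f, W f -> Log_iter_defined k f) /\
    forall l, (forall f, W f -> Log_iter_defined l f) -> (l <= k)%N].

Definition Exp_iter (m : int) f : arith R :=
  match m with
  | Posz n => iter n Exp f
  | Negz n => iter n.+1 Log f
  end.

Definition Exp_star W : set (arith R) :=
  [set h | exists f (m : int),
    [/\ W f, - (kW W)%:Z <= m & h = Exp_iter m f]].

End LogExp.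

(* Independence of the set [X], not of a family: the [x i] are distinct. *)
Definition alg_indep (A : comNzRingType) (K X : set A) : Prop :=
  forall (n : nat) (x : 'I_n -> A) (p : mpoly n A),
    injective x -> (forall i, X (x i)) -> (forall m, K (mcoeff m p)) ->
    meval x p = 0 -> p = 0.

(* Main.v *)
Require Import Defs.
From mathcomp Require Import all_boot all_order all_algebra.
From mathcomp Require Import all_classical all_reals all_analysis.
From mathcomp Require Import complex.
From mathcomp Require Import -(notations) mpoly.
From mathcomp Require Import zify ring lra.

Set Implicit Arguments.
Unset Strict Implicit.
Unset Printing Implicit Defensive.

Import Order.TTheory GRing.Theory Num.Theory.
Import numFieldNormedType.Exports.

Local Open Scope classical_set_scope.
Local Open Scope complex_scope.
Local Open Scope ring_scope.

(** Pointwise multiplication by the [p]-adic valuation is a derivation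
    [theta_p] of the ring of arithmetic functions; it is [dprime p] times the
    indicator function of [p], so it has the same constants as [dprime p], and
    it satisfies [theta_p (Exp g) = Exp g * theta_p g].  Fix an infinite set
    [P] of primes dividing members of the support of [f], chosen such that
    every coefficient of the relation under study is killed by all [theta_p]
    with [p] in [P].  The elements of the set [X] occurring in the relation
    then sit in finitely many chains [y, Exp y, Exp (Exp y), ...], one for each
    pair [(i, j)], whose base [y] is the [k]-fold logarithm of
    [T^(alpha i) (dlog^j f)], with [k] the number of logarithms allowed.

    A single chain is handled by a purely algebraic fact
    ([exp_chain_transc]): if [D] is a derivation of a domain of characteristic
    zero and [D y] is not zero, then [y, Exp y, Exp (Exp y), ...] are
    algebraically independent over the constants of [D].  One element [z] is
    added at a time.  In a relation for [z] of minimal degree, eliminating the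
    leading term between the relation and its derivative produces a
    first-order equation for the quotient of two coefficients, and comparing
    degrees in the preceding element of the chain shows that it has no
    solution.

    To put several chains together it is enough to find, for each of them, a
    derivation [D] killing the bases of the earlier chains but not its own
    base: the whole ring generated by the earlier chains then consists of
    constants of [D] ([families_tower_transc]).  Such a [D] is a linear combination
    of the [theta_p] with arithmetic functions as coefficients.  By linear
    algebra ([common_kernel_dependent]) it exists unless the vectors
    [(theta_p g_s)_(p in P)], with [g_s = T^(alpha i) (dlog^j f)], satisfy a
    linear relation with coefficients [c_s].

    There is no such relation ([twist_indep]), and this is where the support
    of [f] and the numbers [alpha i] enter.  Let [m_p] be the least multiple of
    [p] in the support of [f], and [v] the least point where some [c_s] does
    not vanish.  The coefficient of the relation at [v * m_p] is, up to a
    nonzero factor, the sum of the [c_s v * exp (alpha i * t) * t ^+ j] at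
    [t = ln m_p].  These values of [t] are unbounded, whereas the term of
    largest growth dominates all others for large [t], the real parts of the
    [alpha i] being distinct. *)

(** * Transcendence along a chain of exponentials *)

Section Transcendence.
Context (A : comNzRingType).
Implicit Types (B C : set A) (h p q r : {poly A}) (e x y z : A) (D : A -> A).

Definition subring B := [/\ B 1, forall x y, B x -> B y -> B (x - y)
  & forall x y, B x -> B y -> B (x * y)].

Definition coefs_in B p := forall i, B p`_i.

Definition adjoin B x : set A := [set y | exists2 h, coefs_in B h & y = h.[x]].

Definition transc B x := forall h, coefs_in B h -> h.[x] = 0 -> h = 0.

(** The ring [B[y 0, ..., y k.-1]], built one generator at a time so that
    algebraic independence of the [y i] over [B] reads as a succession of
    transcendence statements in one variable. *)
Fixpoint tower B (y : nat -> A) k : set A :=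
  if k is k'.+1 then adjoin (tower B y k') (y k') else B.

Definition derivation D := (forall x y, D (x + y) = D x + D y) /\
  (forall x y, D (x * y) = D x * y + x * D y).

Definition constants D : set A := [set x | D x = 0].

Section SubringClosure.
Context (B : set A) (sB : subring B).

Lemma subring0 : B 0.
Proof. by have [B1 BB _] := sB; rewrite -(subrr 1); apply: BB. Qed.

Lemma subringN x : B x -> B (- x).
Proof.
have [_ BB _] := sB => Bx; rewrite -(sub0r x).
by apply: BB => //; apply: subring0.
Qed.

Lemma subringD x y : B x -> B y -> B (x + y).
Proof.
have [_ BB _] := sB => Bx By; rewrite -(opprK y).
by apply: BB => //; apply: subringN.
Qed.

Lemma subringM x y : B x -> B y -> B (x * y).
Proof. by have [_ _ +] := sB; apply. Qed.

Lemma subring_sum I (s : seq I) (Q : pred I) (F : I -> A) :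
  (forall i, Q i -> B (F i)) -> B (\sum_(i <- s | Q i) F i).
Proof.
move=> BF; elim/big_rec: _ => [|i y Qi By]; first exact: subring0.
by apply: subringD => //; exact: BF.
Qed.

Lemma subringMn x n : B x -> B (x *+ n).
Proof. by move=> Bx; rewrite -[n]card_ord -sumr_const; apply: subring_sum. Qed.

Lemma coefs_inC c : B c -> coefs_in B c%:P.
Proof. by move=> Bc i; rewrite coefC; case: ifP => // _; apply: subring0. Qed.

Lemma coefs_inX : coefs_in B 'X.
Proof.
have [B1 _ _] := sB => i; rewrite coefX.
by case: eqP => _ //; apply: subring0.
Qed.

Lemma coefs_inB p q : coefs_in B p -> coefs_in B q -> coefs_in B (p - q).
Proof. by have [_ BB _] := sB => Bp Bq i; rewrite coefB; apply: BB. Qed.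

Lemma coefs_inM p q : coefs_in B p -> coefs_in B q -> coefs_in B (p * q).
Proof. by move=> Bp Bq i; rewrite coefM; apply: subring_sum => j _; apply: subringM. Qed.

Lemma coefs_inZ c p : B c -> coefs_in B p -> coefs_in B (c *: p).
Proof. by move=> Bc Bp i; rewrite coefZ; apply: subringM. Qed.

Lemma coefs_in_deriv p : coefs_in B p -> coefs_in B p^`().
Proof. by move=> Bp i; rewrite coef_deriv; apply: subringMn. Qed.

Lemma sub_adjoin x y : B y -> adjoin B x y.
Proof. by move=> By; exists y%:P; [exact: coefs_inC|rewrite hornerC]. Qed.

Lemma mem_adjoin x : adjoin B x x.
Proof. by exists 'X; [exact: coefs_inX|rewrite hornerX]. Qed.

Lemma adjoin_subring x : subring (adjoin B x).
Proof.
split; first by apply: sub_adjoin; case: sB.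
- move=> _ _ [p Bp ->] [q Bq ->]; exists (p - q); first exact: coefs_inB.
  by rewrite !hornerE.
- move=> _ _ [p Bp ->] [q Bq ->]; exists (p * q); first exact: coefs_inM.
  by rewrite !hornerE.
Qed.

End SubringClosure.

Lemma tower_subring B (y : nat -> A) k : subring B -> subring (tower B y k).
Proof. by move=> sB; elim: k => //= k IH; apply: adjoin_subring. Qed.

Lemma tower_sub B C (y z : nat -> A) k : B `<=` C -> (forall i, (i < k)%N -> y i = z i) ->
  tower B y k `<=` tower C z k.
Proof.
move=> BC; elim: k => //= k IH yz x [h Bh ->].
exists h; last by rewrite yz.
by move=> i; apply: IH (Bh i) => j jk; apply: yz; rewrite ltnW.
Qed.

Lemma transc_sub B C x : B `<=` C -> transc C x -> transc B x.
Proof. by move=> BC tx h Bh; apply: tx => i; apply: BC. Qed.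

Section Derivations.
Context (D : A -> A) (derD : derivation D).

Lemma der0 : D 0 = 0.
Proof. by apply: (addrI (D 0)); rewrite addr0 -derD.1 addr0. Qed.

Lemma derN x : D (- x) = - D x.
Proof. by apply/eqP; rewrite -addr_eq0 -derD.1 addNr der0. Qed.

Lemma der1 : D 1 = 0.
Proof. by apply: (addrI (D 1)); rewrite addr0 -{3}(mul1r 1) derD.2 mulr1 mul1r. Qed.

Lemma der_exp x n : D (x ^+ n.+1) = (x ^+ n * D x) *+ n.+1.
Proof.
elim: n => [|n IH]; first by rewrite expr1 expr0 mul1r.
by rewrite exprS derD.2 IH mulrnAr mulrA -exprS [RHS]mulrS [D x * _]mulrC.
Qed.

Lemma der_sum I (s : seq I) (Q : pred I) (F : I -> A) :
  D (\sum_(i <- s | Q i) F i) = \sum_(i <- s | Q i) D (F i).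
Proof. by apply: big_morph; [exact: derD.1|exact: der0]. Qed.

Lemma constants_subring : subring (constants D).
Proof.
split; first exact: der1.
- by move=> x y Dx Dy; rewrite /constants /= derD.1 derN Dx Dy subrr.
- by move=> x y Dx Dy; rewrite /constants /= derD.2 Dx Dy mul0r mulr0 addr0.
Qed.

Lemma der_horner p x :
  D p.[x] = (map_poly D p).[x] + p^`().[x] * D x.
Proof.
elim/poly_ind: p => [|p c IH].
  by rewrite deriv0 map_poly0 !horner0 der0 mul0r addr0.
have -> : map_poly D (p * 'X + c%:P) = map_poly D p * 'X + (D c)%:P.
  apply/polyP => i; rewrite coef_map_id0 ?der0// !coefD !coefMX !coefC.
  case: i => [|i] /=; first by rewrite !add0r.
  by rewrite !addr0 coef_map_id0 ?der0.
rewrite derivMXaddC !(hornerD, hornerM, hornerX, hornerC) derD.1 derD.2 IH.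
by ring.
Qed.

End Derivations.

(** The situation after some steps along a chain: [x] is the last element, [B]
    the ring generated by the previous ones, and [e] the derivative of the base
    of the chain, by which every derivative is divisible.  The derivative of [x]
    is [e * r.[x]], where [r] is 1 at the base of the chain and a nonzero
    multiple of ['X] afterwards.  The size condition says that differentiating
    a polynomial in [x] raises its degree by less than the degree of [r]: this
    is what excludes the equation [D h / h = n * e * r.[x]] and therefore what
    makes an exponential of [x] transcendental. *)
Definition exp_stage D e B x r : Prop :=
  [/\ subring B, transc B x, coefs_in B r /\ r != 0, D x = e * r.[x]
    & forall h, coefs_in B h -> h != 0 -> exists h1,
      [/\ coefs_in B h1, D h.[x] = e * h1.[x]
        & ((size h1).+1 < size h + size r)%N]].

Context (dom : forall x y, x * y = 0 -> x = 0 \/ y = 0)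
  (char0 : forall x n, x *+ n.+1 = 0 -> x = 0).

Lemma dom_neq0 x y : x != 0 -> y != 0 -> x * y != 0.
Proof. by move=> /eqP x0 /eqP y0; apply/eqP => /dom[]. Qed.

Lemma mul_cancel x y z : x != 0 -> x * y = x * z -> y = z.
Proof.
move=> x0 /eqP; rewrite -subr_eq0 -mulrBr => /eqP/dom[/eqP|].
  by rewrite (negPf x0).
by move/eqP; rewrite subr_eq0 => /eqP.
Qed.

(** Differentiating a relation with constant coefficients replaces the
    polynomial by its formal derivative, of smaller degree; by induction that
    derivative is zero, and in characteristic zero the polynomial is constant. *)
Lemma transc_constants D x : derivation D -> D x != 0 -> transc (constants D) x.
Proof.
move=> derD Dx h; move: {2}(size h) (leqnn (size h)) => n.
elim: n h => [|n IH] h; first by rewrite leqn0 size_poly_eq0 => /eqP.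
move=> szh Ch hx.
have mh : map_poly D h = 0.
  by apply/polyP => i; rewrite coef_map_id0 ?(der0 derD)// coef0; exact: Ch.
have /eqP := der_horner derD h x.
rewrite hx der0// mh horner0 add0r eq_sym => /eqP/dom[dhx|/eqP]; last first.
  by rewrite (negPf Dx).
have dh0 : h^`() = 0.
  apply: IH => //; last exact: (coefs_in_deriv (constants_subring derD)).
  by apply: (leq_trans (size_poly _ _)); rewrite -ltnS; case: (size h) szh => //= k; lia.
have hC : h = (h`_0)%:P.
  apply/polyP => -[|i]; rewrite coefC //=.
  by apply: (char0 (n := i)); rewrite -coef_deriv dh0 coef0.
by move: hx; rewrite hC hornerC => ->.
Qed.

Lemma exp_stage0 D x : derivation D -> D x != 0 ->
  exp_stage D (D x) (constants D) x 1.
Proof.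
move=> derD Dx; have sC := constants_subring derD.
split=> //; first exact: transc_constants.
- by split; [rewrite -polyC1; apply: coefs_inC => //; case: sC|exact: oner_neq0].
- by rewrite hornerC mulr1.
- move=> h Ch h0; exists h^`(); split.
  + exact: coefs_in_deriv.
  + rewrite der_horner// (_ : map_poly D h = 0) ?horner0 ?add0r 1?mulrC//.
    by apply/polyP => i; rewrite coef_map_id0 ?(der0 derD)// coef0; exact: Ch.
  + rewrite size_poly1 addn1 ltnS.
    exact: lt_size_deriv.
Qed.

(** Take a relation for [z] over [B[x]] of minimal degree [m], with leading
    coefficient [l] and constant coefficient [c0].  Its derivative is a relation
    of degree at most [m], since [z] is an exponential.  Cancelling leading
    coefficients between the two gives a relation of smaller degree, hence the
    zero polynomial, whose constant coefficient says that [c0 / l] has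
    logarithmic derivative [m * D x].  Written with polynomials in [x], this is
    impossible for reasons of degree. *)
Lemma exp_stageS D e B x r z : derivation D -> e != 0 ->
  exp_stage D e B x r -> z != 0 -> D z = z * D x ->
  exp_stage D e (adjoin B x) z (r.[x] *: 'X).
Proof.
move=> derD e0 [sB tx [Br r0] Dx st] z0 Dz.
have sB' := adjoin_subring sB x; set B' := adjoin B x in sB' *.
pose u := r.[x].
have B'u : B' u by exists r.
have u0 : u != 0 by apply: contra_neq r0; exact: tx.
(* [D] maps [B[x]] into its multiples by [e]; [dd] is [D] divided by [e]. *)
have [dd ddP] : exists dd : A -> A, forall b, B' b -> B' (dd b) /\ D b = e * dd b.
  suff /choice[dd ddP] : forall b, exists b', B' b -> B' b' /\ D b = e * b'.
    by exists dd.
  move=> b; have [[h Bh ->]|nb] := pselect (B' b); last by exists 0.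
  have [->|h0] := eqVneq h 0.
    by exists 0 => _; rewrite horner0 (der0 derD) mulr0; split=> //; apply: subring0.
  have [h1 [Bh1 Dh _]] := st h Bh h0.
  by exists h1.[x] => _; split=> //; exists h1.
have dd0 : dd 0 = 0.
  apply: (mul_cancel e0); rewrite mulr0.
  by have [_ <-] := ddP _ (subring0 sB'); rewrite (der0 derD).
(* The polynomial whose value at [z] is [D p.[z]] divided by [e]. *)
pose lift p := map_poly dd p + u *: (p^`() * 'X).
have liftE p i : (lift p)`_i = dd p`_i + u * (p`_i *+ i).
  rewrite coefD coefZ coefMX coef_map_id0//; congr (_ + u * _).
  by case: i => [|i] /=; rewrite ?mulr0n// coef_deriv.
have size_lift p : (size (lift p) <= size p)%N.
  apply/leq_sizeP => i pi; rewrite liftE (nth_default _ pi) dd0.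
  by rewrite mul0rn mulr0 addr0.
have B'lift p : coefs_in B' p -> coefs_in B' (lift p).
  move=> Bp i; rewrite liftE; apply: (subringD sB'); first by have [] := ddP _ (Bp i).
  by apply: (subringM sB') => //; apply: subringMn.
have Dlift p : coefs_in B' p -> D p.[z] = e * (lift p).[z].
  move=> Bp; rewrite der_horner//.
  have -> : map_poly D p = e *: map_poly dd p.
    apply/polyP => i; rewrite coefZ !coef_map_id0 ?(der0 derD)//.
    by have [] := ddP _ (Bp i).
  by rewrite Dz Dx hornerD !hornerZ hornerMX -/u; ring.
split=> //.
- move=> p; move: {2}(size p) (leqnn (size p)) => n.
  elim: n p => [|n IH] p; first by rewrite leqn0 size_poly_eq0 => /eqP.
  move=> szp Bp pz; have [//|p0] := eqVneq p 0.
  (* If the constant coefficient is zero, a factor [z] can be removed. *)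
  have [c00|c00] := eqVneq p`_0 0.
    have pE : p = drop_poly 1 p * 'X.
      by apply/polyP => -[|i]; rewrite coefMX//= coef_drop_poly addn1.
    suff q0 : drop_poly 1 p = 0 by rewrite pE q0 mul0r.
    apply: IH; first by rewrite size_drop_poly; lia.
      by move=> i; rewrite coef_drop_poly; apply: Bp.
    have := hornerMX (drop_poly 1 p) z; rewrite -pE pz => /esym/dom[//|/eqP].
    by rewrite (negPf z0).
  exfalso; pose m := (size p).-1; pose l := p`_m.
  have l0 : l != 0 by rewrite /l -/(lead_coef p) lead_coef_eq0.
  have m0 : (0 < m)%N.
    rewrite lt0n; apply: contra_neq c00 => m0.
    have pC : p = (p`_0)%:P by apply: size1_polyC; move: m0; rewrite /m; lia.
    by move: pz; rewrite pC hornerC coefC.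
  have szm : size p = m.+1 by rewrite /m prednK// lt0n size_poly_eq0.
  (* The coefficient of [lift p] in degree [m] is [dd l + u * (l *+ m)]. *)
  pose q := l *: lift p - (dd l + u * (l *+ m)) *: p.
  have q0 : q = 0.
    apply: IH.
    - rewrite -ltnS (leq_trans _ szp)// szm ltnS; apply/leq_sizeP => i.
      rewrite leq_eqVlt coefB !coefZ liftE => /predU1P[<-|mi].
        by rewrite -/l mulrC subrr.
      by rewrite nth_default ?szm// dd0 mul0rn !mulr0 addr0 mulr0 subr0.
    - apply: (coefs_inB sB'); apply: (coefs_inZ sB') => //; first exact: Bp.
        exact: B'lift.
      apply: (subringD sB'); first by have [] := ddP _ (Bp m).
      by apply: (subringM sB') => //; apply: subringMn => //; exact: Bp.
    - rewrite hornerD hornerN !hornerZ pz mulr0 subr0.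
      have : e * (lift p).[z] = 0 by rewrite -Dlift// pz (der0 derD).
      by case/dom => [/eqP|->]; rewrite ?(negPf e0)// mulr0.
  have [h Bh hE] := Bp 0; have [g Bg gE] := Bp m; rewrite -/l in gE.
  have h0 : h != 0 by apply: contra_neq c00 => h0; rewrite hE h0 horner0.
  have g0 : g != 0 by apply: contra_neq l0 => g0; rewrite gE g0 horner0.
  have [h1 [Bh1 Dh szh1]] := st h Bh h0.
  have [g1 [Bg1 Dg szg1]] := st g Bg g0.
  have ddh : dd p`_0 = h1.[x].
    by apply: (mul_cancel e0); rewrite -Dh -hE; have [] := ddP _ (Bp 0).
  have ddg : dd l = g1.[x].
    by apply: (mul_cancel e0); rewrite -Dg -gE; have [] := ddP _ (Bp m).
  (* The constant coefficient of [q], read as an identity of polynomials over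
     [B] because [x] is transcendental. *)
  have key : (r * (g * h)) *+ m = g * h1 - g1 * h.
    apply/eqP; rewrite eq_sym -subr_eq0; apply/eqP; apply: tx.
      apply: (coefs_inB sB); first by apply: (coefs_inB sB); apply: coefs_inM.
      by move=> i; rewrite coefMn; apply: (subringMn sB); do 2 apply: coefs_inM => //.
    have : q`_0 = 0 by rewrite q0 coef0.
    rewrite coefB !coefZ liftE ddh ddg mulr0n mulr0 addr0 {1}gE hE gE /u => q00.
    rewrite !(hornerD, hornerN, hornerMn, hornerM) -[RHS]q00.
    rewrite [in RHS]mulrDl [in RHS]mulrnAr [in RHS]mulrnAl -[in RHS](mulrA r.[x]).
    by move: (_ *+ m) => rghm; ring.
  (* The two sides of [key] are compared in the degree of [r * (g * h)]. *)
  have gh : lead_coef g * lead_coef h != 0 by rewrite dom_neq0 ?lead_coef_eq0.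
  have rgh : lead_coef r * lead_coef (g * h) != 0.
    by rewrite lead_coef_proper_mul// dom_neq0 ?lead_coef_eq0.
  have := congr1 (fun p : {poly A} => p`_(size (r * (g * h))).-1) key.
  rewrite coefMn -/(lead_coef _) lead_coef_proper_mul//.
  have size_gt0 (s : {poly A}) : s != 0 -> (0 < size s)%N by rewrite lt0n size_poly_eq0.
  have {}r0 := size_gt0 _ r0; have {}g0 := size_gt0 _ g0; have {}h0 := size_gt0 _ h0.
  rewrite size_proper_mul// size_proper_mul//.
  have := size_polyMleq g h1; have := size_polyMleq g1 h => s1 s2.
  rewrite coefB (@nth_default _ _ (g * h1)) ?(@nth_default _ _ (g1 * h)); last 2 first.
    by apply: leq_trans s1 _; lia.
    by apply: leq_trans s2 _; lia.
  rewrite subrr.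
  case: (m) m0 => // m' _ /char0 /eqP.
  by rewrite (negPf rgh).
- split; first by apply: (coefs_inZ sB') => //; exact: coefs_inX.
  apply: contra_neq u0 => /(congr1 (fun p : {poly A} => p`_1)).
  by rewrite coefZ coefX mulr1 coef0.
- by rewrite Dz Dx hornerZ hornerX mulrCA [z * _]mulrC.
- move=> h Bh h0; exists (lift h); split; [exact: B'lift|exact: Dlift|].
  have -> : size (u *: 'X) = 2%N.
    by rewrite -mul_polyC size_mulX ?polyC_eq0// size_polyC u0.
  by have := size_lift h; lia.
Qed.

(** Each [y m.+1] plays the role of the exponential of [y m]: it satisfies the
    same differential equation. *)
Lemma exp_chain_transc D (y : nat -> A) : derivation D -> D (y 0%N) != 0 ->
  (forall m, y m.+1 != 0) -> (forall m, D (y m.+1) = y m.+1 * D (y m)) ->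
  forall m, transc (tower (constants D) y m) (y m).
Proof.
move=> derD Dy0 yn0 Dy m.
suff [r []] : exists r, exp_stage D (D (y 0%N)) (tower (constants D) y m) (y m) r.
  by [].
elim: m => [|m [r st]]; first by exists 1; apply: exp_stage0.
by exists (r.[y m] *: 'X); apply: exp_stageS.
Qed.

End Transcendence.

(** * Algebraic independence from a tower of simple extensions *)

Section Families.
Context (A : comNzRingType).
Implicit Types (B C K : set A) (x : A) (D : A -> A).

Lemma adjoin_subset B C x : subring C -> B `<=` C -> C x -> adjoin B x `<=` C.
Proof.
move=> sC BC Cx _ [h Bh ->]; elim/poly_ind: h Bh => [|h c IH] Bh.
  by rewrite horner0; apply: subring0.
rewrite hornerMXaddC; apply: (subringD sC).
  apply: (subringM sC) => //; apply: IH => i.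
  by have := Bh i.+1; rewrite coefD coefMX coefC /= addr0.
by apply: BC; have := Bh 0%N; rewrite coefD coefMX coefC /= add0r.
Qed.

Lemma tower_subset B C (z : nat -> A) k : subring C -> B `<=` C ->
  (forall i, (i < k)%N -> C (z i)) -> tower B z k `<=` C.
Proof.
move=> sC BC; elim: k => //= k IH Cz; apply: adjoin_subset => //; last exact: Cz.
by apply: IH => i ik; apply: Cz; rewrite ltnW.
Qed.

Lemma tower_add B (z : nat -> A) k m :
  tower B z (k + m) = tower (tower B z k) (fun i => z (k + i)%N) m.
Proof. by elim: m => [|m IH]; rewrite ?addn0// addnS /= IH. Qed.

Lemma subset_tower B (z : nat -> A) k : subring B -> B `<=` tower B z k.
Proof.
move=> sB; elim: k => //= k IH x /IH Bx.
by apply: sub_adjoin => //; apply: tower_subring.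
Qed.

Lemma mem_tower B (z : nat -> A) k i : subring B -> (i < k)%N -> tower B z k (z i).
Proof.
move=> sB; elim: k => //= k IH; rewrite ltnS leq_eqVlt => /predU1P[->|ik].
  by apply: mem_adjoin; apply: tower_subring.
by apply: sub_adjoin; [apply: tower_subring|apply: IH].
Qed.

Lemma subring_prod B I (s : seq I) (F : I -> A) : subring B ->
  (forall i, B (F i)) -> B (\prod_(i <- s) F i).
Proof.
move=> sB BF; elim/big_rec: _ => [|i y _ By]; first by case: sB.
exact: subringM.
Qed.

Lemma subring_exp B x n : subring B -> B x -> B (x ^+ n).
Proof. by move=> sB Bx; rewrite -[n]card_ord -prodr_const; apply: subring_prod. Qed.

(** Grouping the monomials by their exponent in the last generator turns a
    linear relation between them into a polynomial relation for this generator
    over the ring below it. *)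
Lemma tower_monomials_free K (z : nat -> A) N : subring K ->
  (forall k, (k < N)%N -> transc (tower K z k) (z k)) ->
  forall (I : eqType) (r : seq I) (c : I -> A) (a : I -> nat -> nat),
  uniq r -> (forall i, K (c i)) ->
  {in r &, forall i j, (forall k, (k < N)%N -> a i k = a j k) -> i = j} ->
  \sum_(i <- r) c i * \prod_(k < N) z k ^+ a i k = 0 ->
  {in r, forall i, c i = 0}.
Proof.
move=> sK; elim: N => [|N IH] tz I r c a ur Kc ainj s0 i ri.
  move: s0; rewrite (bigD1_seq i)//= big_ord0 mulr1 big_seq_cond big1 ?addr0//.
  by move=> j /andP[rj /eqP[]]; apply: ainj.
pose mon i := c i * \prod_(k < N) z k ^+ a i k.
pose p := \sum_(i <- r) mon i *: 'X^(a i N).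
have sT := tower_subring z N sK.
have p0 : p = 0.
  apply: (tz N) => //.
    move=> e; rewrite coef_sum; apply: (subring_sum sT) => j _.
    rewrite coefZ coefXn; apply: (subringM sT); last first.
      by apply: (subringMn sT); case: sT.
    apply: (subringM sT); first exact: subset_tower.
    by apply: subring_prod => // k; apply: subring_exp => //; apply: mem_tower.
  rewrite horner_sum -[RHS]s0; apply: eq_bigr => j _.
  by rewrite hornerZ hornerXn big_ord_recr /= mulrA.
apply: (IH _ _ [seq j <- r | a j N == a i N] c a) => //.
- by move=> k kN; apply: tz; rewrite ltnW.
- exact: filter_uniq.
- move=> j k; rewrite !mem_filter => /andP[/eqP jN rj] /andP[/eqP kN rk] jk.
  apply: ainj => // l; rewrite ltnS leq_eqVlt => /predU1P[->|]; last exact: jk.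
  by rewrite jN kN.
- rewrite big_filter.
  have : p`_(a i N) = 0 by rewrite p0 coef0.
  rewrite coef_sum => p0'; rewrite -[RHS]p0' big_mkcond /=; apply: eq_bigr => j _.
  by rewrite coefZ coefXn eq_sym; case: eqP; rewrite ?mulr1 ?mulr0.
- by rewrite mem_filter eqxx.
Qed.

(** The [x i] may be any subfamily of the generators, in any order: distinct
    monomials in the [x i] are distinct monomials in the [z j]. *)
Lemma tower_alg_indep K (z : nat -> A) N n (x : 'I_n -> A) (k : 'I_n -> nat)
    (p : mpoly n A) : subring K ->
  (forall i, (i < N)%N -> transc (tower K z i) (z i)) ->
  injective k -> (forall i, (k i < N)%N) -> (forall i, x i = z (k i)) ->
  (forall m, K (mcoeff m p)) -> meval x p = 0 -> p = 0.
Proof.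
move=> sK tz kinj kN xz Kp px.
(* The exponent vector of a monomial in [x], extended by zero to all of [z]. *)
pose a (m : multinom n) j := (\sum_(i < n | k i == j) m i)%N.
suff p0 : {in msupp p, forall m, mcoeff m p = 0}.
  apply/mpolyP => m; rewrite mcoeff0.
  by have [/p0//|/memN_msupp_eq0] := boolP (m \in msupp p).
apply: (tower_monomials_free sK tz (r := msupp p)
  (c := fun m => mcoeff m p) (a := a)) => //.
- move=> m m' _ _ mm'; apply/mnmP => i; have := mm' _ (kN i).
  have aE (q : multinom n) : a q (k i) = q i.
    by rewrite /a (big_pred1 i)// => j; rewrite (inj_eq kinj).
  by rewrite !aE.
- rewrite -[RHS]px mevalE; apply: eq_bigr => m _; congr (_ * _).
  have -> : \prod_(i < n) x i ^+ m i =
      \prod_(j < N) \prod_(i < n | k i == j) z j ^+ m i.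
    rewrite (partition_big (fun i => Ordinal (kN i)) predT)//=.
    apply: eq_bigr => j _; apply: eq_big => i //=.
    by move=> /eqP <- /=; rewrite xz.
  by apply: eq_bigr => j _; rewrite -expr_sum.
Qed.

(** The generators are listed chain after chain: the number [k] codes the
    element of rank [k %% M.+1] in the chain [k %/ M.+1].  When chain [s]
    begins, all earlier generators are constants of [D s], so that the
    statement for one chain over the constants of [D s] applies. *)
Lemma families_tower_transc K n M (y : nat -> nat -> A) (D : nat -> A -> A) :
  (forall x y, x * y = 0 -> x = 0 \/ y = 0 :> A) ->
  (forall (x : A) n, x *+ n.+1 = 0 -> x = 0) ->
  (forall s, (s < n)%N -> [/\ derivation (D s), K `<=` constants (D s),
     D s (y s 0%N) != 0, forall t m, (t < s)%N -> D s (y t m) = 0 &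
     forall m, D s (y s m.+1) = y s m.+1 * D s (y s m)]) ->
  (forall s m, y s m.+1 != 0) ->
  let z k := y (k %/ M.+1)%N (k %% M.+1)%N in
  forall k, (k < n * M.+1)%N -> transc (tower K z k) (z k).
Proof.
move=> dom char0 Ds y0 z k kn.
pose s := (k %/ M.+1)%N; pose m := (k %% M.+1)%N.
have sn : (s < n)%N by rewrite /s ltn_divLR.
have [derD KD Dy0 Dyt Dym] := Ds s sn.
have sC := constants_subring derD.
have : transc (tower (constants (D s)) (y s) m) (y s m).
  exact: (exp_chain_transc dom char0 derD Dy0 (y0 s) Dym).
apply: transc_sub; rewrite (divn_eq k M.+1) -/s -/m tower_add.
have mM : (m < M.+1)%N by rewrite ltn_mod.
apply: tower_sub.
  apply: tower_subset => // i ism; apply: Dyt.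
  by rewrite ltn_divLR.
move=> i im; rewrite /z divnMDl// modnMDl divn_small ?modn_small ?addn0//;
  exact: ltn_trans mM.
Qed.

(** * Linear functionals and common kernels *)

Definition lincomb I (v : seq (A * I)) (l : I -> A) := \sum_(q <- v) q.1 * l q.2.

(** Over a field: a functional vanishing on the common kernel of [l 0], ...,
    [l n.-1] is a linear combination of them.  Over a domain a denominator [c]
    appears.  In the induction either the last functional vanishes on the
    common kernel of the others and can be dropped, or some [w] in that kernel
    has [lincomb w (l n) != 0], and [w] serves to project the kernel of the
    others onto the common kernel. *)
Lemma common_kernel_dependent I n (l : nat -> I -> A) (la : I -> A) :
  (forall x y, x * y = 0 -> x = 0 \/ y = 0 :> A) ->
  (forall v, (forall i, (i < n)%N -> lincomb v (l i) = 0) -> lincomb v la = 0) ->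
  exists c (a : nat -> A),
    c != 0 /\ forall p, c * la p = \sum_(i < n) a i * l i p.
Proof.
move=> dom; elim: n la => [|n IH] la hla.
  exists 1, (fun=> 0); split; first exact: oner_neq0.
  move=> p; rewrite big_ord0 -(hla [:: (1, p)])//.
  by rewrite /lincomb big_seq1.
have [ln|/existsNP[w /not_implyP[w0 /eqP wn]]] := pselect (forall v,
    (forall i, (i < n)%N -> lincomb v (l i) = 0) -> lincomb v (l n) = 0).
  have [v hv|c [a [c0 ca]]] := IH la.
    apply: hla => i; rewrite ltnS leq_eqVlt => /predU1P[->|]; last exact: hv.
    exact: ln.
  exists c, (fun i => if i == n then 0 else a i); split=> // p.
  rewrite big_ord_recr /= eqxx mul0r addr0 ca; apply: eq_bigr => i _.
  by rewrite (ltn_eqF (ltn_ord i)).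
(* The projection of [v] along [w], multiplied by [lincomb w (l n)]. *)
pose comb v := [seq (lincomb w (l n) * q.1, q.2) | q <- v] ++
  [seq (- lincomb v (l n) * q.1, q.2) | q <- w].
have combE v f : lincomb (comb v) f =
    lincomb w (l n) * lincomb v f - lincomb v (l n) * lincomb w f.
  rewrite {1}/lincomb big_cat !big_map /= -mulNr; congr (_ + _).
    by rewrite mulr_sumr; apply: eq_bigr => q _; rewrite mulrA.
  by rewrite mulr_sumr; apply: eq_bigr => q _; rewrite mulrA.
have [v hv|c [a [c0 ca]]] := IH (fun p => lincomb w (l n) * la p - lincomb w la * l n p).
  have : lincomb (comb v) la = 0.
    apply: hla => i; rewrite combE ltnS leq_eqVlt => /predU1P[->|li].
      by rewrite mulrC subrr.
    by rewrite (hv i)// (w0 i)// !mulr0 subrr.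
  rewrite combE => <-; rewrite /lincomb [X in _ - X]mulr_suml mulr_sumr -sumrB.
  by apply: eq_bigr => q _; ring.
exists (c * lincomb w (l n)), (fun i => if i == n then c * lincomb w la else a i).
split; first exact: dom_neq0.
move=> p; rewrite big_ord_recr /= eqxx.
rewrite (eq_bigr (fun i : 'I_n => a i * l i p)); last first.
  by move=> i _; rewrite (ltn_eqF (ltn_ord i)).
by rewrite -ca; ring.
Qed.

End Families.

(** * Leading terms, weights and power series *)

Section Arithmetic.
Context (R : realType).
Implicit Types (f g h u : arith R) (w : nat -> R[i]) (c : nat -> R[i]).

Lemma arithBE f g n : (f - g) n = f n - g n.
Proof. by rewrite arithDE arithNE. Qed.

Lemma arithZE (a : R[i]) f n : (a *: f) n = a * f n.
Proof. by case: n => [|n]; rewrite ?arith0 ?mulr0. Qed.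

Lemma arith_sumE I (s : seq I) (Q : pred I) (F : I -> arith R) n :
  (\sum_(i <- s | Q i) F i) n = \sum_(i <- s | Q i) F i n.
Proof.
by apply: (big_morph (fun f : arith R => f n)) => [f g|];
  rewrite ?arithDE ?arith0E.
Qed.

Lemma arith1E n : (1 : arith R) n = (n == 1%N)%:R.
Proof. by case: n. Qed.

Lemma arithME f g n : (0 < n)%N ->
  (f * g) n = \sum_(d <- divisors n) f d * g (n %/ d)%N.
Proof. by move=> n0; rewrite [LHS]mk_arithE. Qed.

Lemma eq_arithM f f' g g' n : (forall m, (0 < m <= n)%N -> f m = f' m) ->
  (forall m, (0 < m <= n)%N -> g m = g' m) -> (f * g) n = (f' * g') n.
Proof.
move=> ff gg; case: (posnP n) => [->|n0]; first by rewrite !arith0.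
rewrite !arithME// big_seq [RHS]big_seq; apply: eq_bigr => d.
rewrite -dvdn_divisors// => dn; have d0 := dvdn_gt0 n0 dn.
have dln : (d <= n)%N by apply: dvdn_leq.
by rewrite (ff d) ?d0// (gg (n %/ d)%N)// divn_gt0// dln leq_div.
Qed.

Lemma arithM_lead f g a b : (0 < a)%N -> (0 < b)%N ->
  (forall d, (d < a)%N -> f d = 0) -> (forall e, (e < b)%N -> g e = 0) ->
  (f * g) (a * b)%N = f a * g b.
Proof.
move=> a0 b0 fa gb; have ab0 : (0 < a * b)%N by rewrite muln_gt0 a0.
rewrite arithME// (bigD1_seq a) ?divisors_uniq -?dvdn_divisors ?dvdn_mulr//=.
rewrite mulKn// big_seq_cond big1 ?addr0// => d.
rewrite -dvdn_divisors// => /andP[dab da]; have d0 := dvdn_gt0 ab0 dab.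
case: (ltngtP d a) da => // [da|ad] _; first by rewrite fa ?mul0r.
by rewrite gb ?mulr0// ltn_divLR// mulnC ltn_pmul2l.
Qed.

Lemma arithM1 f g : (f * g) 1%N = f 1%N * g 1%N.
Proof.
by apply: (@arithM_lead f g 1 1) => // -[|//] _; rewrite arith0.
Qed.

Lemma arith_lead f : f != 0 -> exists a,
  [/\ (0 < a)%N, f a != 0 & forall d, (d < a)%N -> f d = 0].
Proof.
move=> /vminP[fv minv]; exists (vmin f); split=> //.
  by case: (vmin f) fv => //; rewrite /supp/= arith0 eqxx.
by move=> d dv; apply/eqP/negPn/negP => /minv; rewrite leqNgt dv.
Qed.

Lemma arith_dom f g : f * g = 0 -> f = 0 \/ g = 0.
Proof.
move=> fg; have [->|f0] := eqVneq f 0; [by left|right].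
apply/eqP/negPn/negP => g0.
have [a [a0 fa fd]] := arith_lead f0; have [b [b0 gb ge]] := arith_lead g0.
have := arithM_lead a0 b0 fd ge; rewrite fg arith0E => /esym/eqP.
by rewrite mulf_eq0 (negPf fa) (negPf gb).
Qed.

Lemma arith_char0 f n : f *+ n.+1 = 0 -> f = 0.
Proof.
rewrite -scaler_nat => fn; apply: arithP => m _.
have := congr1 (fun f : arith R => f m) fn.
rewrite arithZE arith0E => /eqP; rewrite mulf_eq0 pnatr_eq0 /=.
by move=> /eqP.
Qed.

(** Two kinds of weights matter: the logarithm, for which this is [dlog], and
    the [p]-adic valuations. *)
Definition wder w f : arith R := mk_arith (fun n => w n * f n).

Definition additive_weight w :=
  forall a b, (0 < a)%N -> (0 < b)%N -> w (a * b)%N = w a + w b.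

Lemma wderE w f n : (wder w f) n = w n * f n.
Proof. by case: n => [|n]; rewrite ?arith0 ?mulr0. Qed.

Lemma wder_derivation w : additive_weight w -> derivation (wder w).
Proof.
move=> ww; split=> f g; apply: arithP => n n0.
  by rewrite wderE !arithDE !wderE mulrDr.
rewrite wderE arithDE !arithME// mulr_sumr -big_split big_seq [RHS]big_seq.
apply: eq_bigr => d; rewrite -dvdn_divisors// => dn.
have d0 := dvdn_gt0 n0 dn.
have nd0 : (0 < n %/ d)%N by rewrite divn_gt0// dvdn_leq.
have -> : w n = w d + w (n %/ d)%N by rewrite -ww// mulnC divnK.
by rewrite !wderE mulrDl mulrA [X in _ + X]mulrCA.
Qed.

Lemma wderZ w (a : R[i]) f : wder w (a *: f) = a *: wder w f.
Proof. by apply: arithP => n n0; rewrite wderE !arithZE wderE mulrCA. Qed.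

Lemma wder_alg w (a : R[i]) : additive_weight w -> wder w a%:A = 0.
Proof. by move=> ww; rewrite wderZ (der1 (wder_derivation ww)) scaler0. Qed.

(** The power series [c] at an [u] with [u 1 = 0].  Since [u ^+ k] vanishes on
    [1, ..., k], the value at [n] only involves finitely many terms. *)
Definition pser c u : arith R :=
  mk_arith (fun n => \sum_(k < n.+1) c k * (u ^+ k) n).

Definition psum c u N : arith R := \sum_(k < N.+1) c k *: u ^+ k.

Lemma expr_vanish u k n : u 1%N = 0 -> (0 < n)%N -> (n <= k)%N -> (u ^+ k) n = 0.
Proof.
move=> u1; elim: k n => [|k IH] n n0; first by rewrite leqNgt n0.
move=> nk; rewrite exprS arithME// big_seq big1// => d.
rewrite -dvdn_divisors// => dn; have d0 := dvdn_gt0 n0 dn.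
have [->|d1] := eqVneq d 1%N; first by rewrite u1 mul0r.
rewrite (IH (n %/ d)%N) ?mulr0//; first by rewrite divn_gt0// dvdn_leq.
by rewrite -ltnS; apply: leq_trans nk; apply: ltn_Pdiv => //; lia.
Qed.

Lemma pserE c u N n : u 1%N = 0 -> (0 < n)%N -> (n <= N)%N ->
  (pser c u) n = (psum c u N) n.
Proof.
move=> u1 n0 nN; rewrite mk_arithE//.
have -> : (psum c u N) n = \sum_(k < N.+1) c k * (u ^+ k) n.
  by rewrite /psum arith_sumE; apply: eq_bigr => k _; rewrite arithZE.
rewrite -(subnKC nN); elim: (N - n)%N => [|j IH]; first by rewrite addn0.
by rewrite addnS [in RHS]big_ord_recr /= -IH expr_vanish ?mulr0 ?addr0//; lia.
Qed.

Lemma pser1 c u : u 1%N = 0 -> (pser c u) 1%N = c 0%N.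
Proof.
move=> u1; rewrite mk_arithE// !big_ord_recl big_ord0 /=.
by rewrite expr_vanish// mulr1 mulr0 !addr0.
Qed.

(** The partial sum of length [N] agrees with the limit at all [n < N], so its
    distance to the limit is at most [1 / N]. *)
Lemma pser_cvg c u : u 1%N = 0 ->
  limn (series (fun k => c k *: u ^+ k)) = pser c u.
Proof.
move=> u1; apply: cvg_lim; first exact: metric_hausdorff.
apply/cvg_ballP => e e0; near=> N.
rewrite ballEmdist /= -[mdist _ _]/(anorm (pser c u - series _ N)).
set d := _ - _.
have [->|d0] := eqVneq d 0; first by rewrite anorm0.
have N0 : (0 < N)%N by near: N; exists 1%N.
have dN m : (m < N)%N -> d m = 0.
  case: m => [|m] mN; first by rewrite arith0.
  rewrite /d arithBE (@pserE _ _ N.-1)//; last by lia.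
  by rewrite /series /= /psum prednK// big_mkord subrr.
have [dv _] := vminP d0.
have Nv : (N <= vmin d)%N by rewrite leqNgt; apply/negP => /dN /eqP; apply/negP.
rewrite /anorm (negPf d0).
apply: (@le_lt_trans _ _ (N%:R^-1)).
  by rewrite lef_pV2 ?posrE ?ltr0n ?ler_nat//; apply: leq_trans Nv.
rewrite invf_plt ?posrE ?ltr0n//.
near: N; exact: nbhs_infty_gtr.
Unshelve. all: by end_near. Qed.

End Arithmetic.

(** * Exponential and logarithm *)

Section ExpLog.
Context (R : realType).
Implicit Types (f g h u : arith R) (w : nat -> R[i]) (c : nat -> R[i]).

Definition exp_coef (k : nat) : R[i] := k`!%:R^-1.

Definition nonconst f : arith R := f - (f 1%N)%:A.

Lemma nonconst1 f : nonconst f 1%N = 0.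
Proof. by rewrite arithBE arithZE arith1E eqxx mulr1 subrr. Qed.

Lemma ExpE f : Exp f = cexp (f 1%N) *: pser exp_coef (nonconst f).
Proof. by rewrite /Exp pser_cvg ?mulr_algl//; exact: nonconst1. Qed.

Lemma Exp1 f : (Exp f) 1%N = cexp (f 1%N).
Proof.
by rewrite ExpE arithZE pser1 ?nonconst1// /exp_coef fact0 invr1 mulr1.
Qed.

Lemma cexp_neq0 (z : R[i]) : cexp z != 0.
Proof.
rewrite eq_complex /= !mulf_eq0 !(gt_eqF (expR_gt0 _)) /=.
apply/negP => /andP[/eqP c0 /eqP s0].
have := cos2Dsin2 (complex.Im z); rewrite c0 s0 expr0n /= addr0 => /eqP.
by rewrite eq_sym oner_eq0.
Qed.

Lemma Exp_neq0 f : Exp f != 0.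
Proof.
apply: contra_neq (cexp_neq0 (f 1%N)) => Ef.
by rewrite -Exp1 Ef arith0E.
Qed.

(** At a given [n] the series may be replaced by a partial sum, for which the
    chain rule is a finite computation that shortens the sum by one term. *)
Lemma wder_Exp w f : additive_weight w -> wder w (Exp f) = Exp f * wder w f.
Proof.
move=> ww; have dw := wder_derivation ww.
rewrite ExpE wderZ -scalerAl; congr (_ *: _).
set u := nonconst f; have u1 : u 1%N = 0 by exact: nonconst1.
have -> : wder w f = wder w u by rewrite /u /nonconst dw.1 derN// wder_alg// subr0.
apply: arithP => n n0.
have -> : (pser exp_coef u * wder w u) n = (psum exp_coef u n * wder w u) n.
  by apply: eq_arithM => // m /andP[m0 mn]; apply: pserE.
rewrite wderE (@pserE _ _ _ n.+1)// -wderE; congr (afun _ n).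
rewrite /psum der_sum// big_ord_recl wderZ expr0 der1// scaler0 add0r mulr_suml.
apply: eq_bigr => k _; rewrite wderZ /= der_exp// -scalerAl -scaler_nat scalerA.
congr (_ *: _); rewrite /exp_coef factS natrM invfM mulrAC mulVf ?mul1r//.
Qed.

(** The inverse of [f] is a geometric series in [u = 1 - f / f 1]. *)
Lemma arith_div f g : f 1%N != 0 -> exists h, f * h = g.
Proof.
move=> f1; pose u := 1 - (f 1%N)^-1 *: f.
have u1 : u 1%N = 0 by rewrite arithBE arithZE arith1E eqxx mulVf// subrr.
have uv : (1 - u) * pser (fun=> 1) u = 1.
  apply: arithP => n n0.
  have -> : ((1 - u) * pser (fun=> 1) u) n = ((1 - u) * psum (fun=> 1) u n) n.
    by apply: eq_arithM => // m /andP[m0 mn]; apply: pserE.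
  have -> : psum (fun=> 1) u n = \sum_(k < n.+1) u ^+ k.
    by apply: eq_bigr => k _; rewrite scale1r.
  have -> : (1 - u) * \sum_(k < n.+1) u ^+ k = 1 - u ^+ n.+1.
    by rewrite -(opprB u 1) mulNr -subrX1 opprB.
  by rewrite arithBE expr_vanish// subr0.
have fE : f = f 1%N *: (1 - u) by rewrite /u opprB addrC subrK scalerA mulfV// scale1r.
exists ((f 1%N)^-1 *: (pser (fun=> 1) u * g)).
by rewrite {1}fE -scalerAl -scalerAr scalerA mulfV// scale1r mulrA uv mul1r.
Qed.

Lemma lnC_weight : additive_weight (fun n => (ln (n%:R : R))%:C).
Proof.
by move=> a b a0 b0; rewrite natrM lnM ?posrE ?ltr0n// rmorphD.
Qed.

Lemma lnC_neq0 n : (1 < n)%N -> (ln (n%:R : R))%:C != 0.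
Proof.
move=> n1; apply/eqP => /(congr1 (@complex.Re R)) /= /eqP.
by rewrite gt_eqF// ln_gt0// ltr1n.
Qed.

(** A linear first-order differential equation has at most one solution with
    given value at 1: at the least point [a > 1] of the support of a difference
    of solutions, the equation reads [ln a * d a = 0]. *)
Lemma dlog_eq f g h : h 1%N = 0 -> f 1%N = g 1%N ->
  dlog f = f * h -> dlog g = g * h -> f = g.
Proof.
move=> h1 fg fh gh; apply/eqP; rewrite -subr_eq0; apply/negPn/negP => d0.
have [a [a0 da dlt]] := arith_lead d0.
have dE : dlog (f - g) = (f - g) * h.
  have [dD _] := wder_derivation lnC_weight.
  rewrite mulrBl -fh -gh; apply: arithP => n n0.
  by rewrite arithBE [LHS]mk_arithE// ![dlog _ n]mk_arithE// arithBE mulrBr.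
have a1 : (1 < a)%N.
  rewrite ltn_neqAle a0 andbT eq_sym; apply: contra_neq da => ->.
  by rewrite arithBE fg subrr.
have /eqP : ((f - g) * h) (a * 1)%N = 0.
  rewrite arithM_lead ?h1 ?mulr0// => -[|//] _; exact: arith0.
rewrite muln1 -dE [dlog _ a]mk_arithE// mulf_eq0 (negPf da).
by rewrite (negPf (lnC_neq0 a1)).
Qed.

(** The function [g] is found by integrating the logarithmic derivative of [f]:
    [dlog g = h] where [f * h = dlog f].  Then [Exp g] and [f] satisfy the same
    differential equation and have the same value at 1. *)
Lemma Exp_surj f : A_pos f -> exists g, A_real g /\ Exp g = f.
Proof.
move=> [Imf Ref].
have f1 : f 1%N = (complex.Re (f 1%N))%:C.
  by apply/eqP; rewrite eq_complex /= Imf !eqxx.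
have f10 : f 1%N != 0.
  by rewrite f1; apply/eqP => /(congr1 (@complex.Re R)) /= /eqP; rewrite gt_eqF.
have [h fh] := arith_div (dlog f) f10.
have h1 : h 1%N = 0.
  have := congr1 (fun f : arith R => f 1%N) fh.
  rewrite arithM1 [dlog _ _]mk_arithE// ln1 mul0r => /eqP.
  by rewrite mulf_eq0 (negPf f10) => /eqP.
pose g : arith R := mk_arith (fun n =>
  if n == 1%N then (ln (complex.Re (f 1%N)))%:C else (ln (n%:R : R))%:C^-1 * h n).
have g1 : g 1%N = (ln (complex.Re (f 1%N)))%:C by [].
exists g; split; first by rewrite /A_real /mkset g1.
apply: (dlog_eq h1).
- rewrite Exp1 g1 /cexp /= lnK ?posrE// cos0 sin0 mulr1 mulr0.
  by rewrite [RHS]f1.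
- have -> : dlog (Exp g) = Exp g * dlog g by exact: (wder_Exp _ lnC_weight).
  congr (_ * _); apply: arithP => n n0.
  rewrite mk_arithE//; have [->|n1] := eqVneq n 1%N; first by rewrite ln1 mul0r.
  rewrite /g mk_arithE// (negPf n1) mulVKf// lnC_neq0//; lia.
- exact: esym.
Qed.

Lemma LogK f : A_pos f -> Exp (Log f) = f.
Proof. by move=> /Exp_surj /xgetPex => /(_ 0) []. Qed.

Lemma iter_ExpLog k f : Log_iter_defined k f ->
  forall m, (m <= k)%N -> iter m (@Exp R) (iter k (@Log R) f) = iter (k - m) (@Log R) f.
Proof.
move=> Lf; elim=> [|m IH] mk; first by rewrite subn0.
rewrite iterS IH; last exact: ltnW.
have -> : (k - m = (k - m.+1).+1)%N by lia.
by rewrite iterS LogK//; apply: Lf; lia.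
Qed.

End ExpLog.

(** * Linear independence of exponential monomials *)

Section Growth.
Context (R : realType).
Implicit Types (f g h : arith R).

Definition cnorm (z : R[i]) : R := complex.Re `|z|.

Lemma cnormE (z : R[i]) : `|z| = (cnorm z)%:C.
Proof. by rewrite /cnorm normc_def. Qed.

Lemma cnorm_gt0 (z : R[i]) : z != 0 -> 0 < cnorm z.
Proof. by rewrite -normr_gt0 cnormE ltcR. Qed.

Lemma cnorm_ge0 (z : R[i]) : 0 <= cnorm z.
Proof. by have := normr_ge0 z; rewrite cnormE lecR. Qed.

Lemma cnormM (z t : R[i]) : cnorm (z * t) = cnorm z * cnorm t.
Proof. by apply: complexI; rewrite rmorphM -!cnormE normrM. Qed.

Definition exp_mono (a : R[i]) (j : nat) (t : R) : R[i] := cexp (a * t%:C) * t%:C ^+ j.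

Lemma cnorm_exp_mono a j t : 0 <= t ->
  cnorm (exp_mono a j t) = expR (complex.Re a * t) * t ^+ j.
Proof.
move=> t0; rewrite cnormM; congr (_ * _).
  rewrite /cnorm normc_def /= !exprMn -mulrDr cos2Dsin2 mulr1 sqrtr_sqr.
  by case: a => a b /=; rewrite mulr0 subr0 ger0_norm// expR_ge0.
rewrite -rmorphXn /cnorm normc_def /= expr0n addr0 sqrtr_sqr ger0_norm//.
exact: exprn_ge0.
Qed.

(** If [a < b], the bound [expR x >= x ^+ j.+1 / j.+1`!] at [x = (b - a) * t]
    beats [t ^+ j] by a factor proportional to [t]. *)
Lemma exp_mono_dominated (a b : R) (j k : nat) (e : R) : 0 < e ->
  (a < b \/ a = b /\ (j < k)%N) ->
  \forall t \near +oo, expR (a * t) * t ^+ j <= e * (expR (b * t) * t ^+ k).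
Proof.
move=> e0 [ab|[<- jk]].
  have d0 : 0 < b - a by rewrite subr_gt0.
  pose C : R := j.+1`!%:R / (b - a) ^+ j.+1.
  near=> t.
  have t1 : 1 <= t by near: t; apply: nbhs_pinfty_ge; exact: num_real.
  have t0 : 0 <= t by apply: le_trans t1.
  have tC : C / e <= t by near: t; apply: nbhs_pinfty_ge; exact: num_real.
  have -> : expR (b * t) = expR (a * t) * expR ((b - a) * t).
    by rewrite -expRD; congr expR; ring.
  rewrite -mulrA mulrCA ler_pM2l ?expR_gt0//.
  have tk : 1 <= t ^+ k by rewrite exprn_ege1.
  apply: (@le_trans _ _ (e * expR ((b - a) * t))); last first.
    by rewrite mulrA ler_peMr// mulr_ge0 ?expR_ge0// ltW.
  have h := expR_ge1Dxn j (mulr_ge0 (ltW d0) t0).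
  have f0 : 0 < j.+1`!%:R :> R by rewrite ltr0n fact_gt0.
  have : e * (((b - a) * t) ^+ j.+1 / j.+1`!%:R) <= e * expR ((b - a) * t).
    by rewrite ler_pM2l//; apply: le_trans h; rewrite lerDr.
  apply: le_trans.
  have -> : e * (((b - a) * t) ^+ j.+1 / j.+1`!%:R) = t ^+ j * (e * t / C).
    have X0 : (b - a) ^+ j.+1 != 0 by rewrite expf_neq0// gt_eqF.
    rewrite /C exprMn [t ^+ j.+1]exprS; move: X0 (gt_eqF f0).
    move: (_ ^+ j.+1) (_`!%:R) (t ^+ j) => X f' tj X0 f0'; field.
    by rewrite X0 f0'.
  have C0 : 0 < C by rewrite divr_gt0// exprn_gt0.
  rewrite ler_peMr ?exprn_ge0// ler_pdivlMr// mul1r mulrC.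
  by rewrite -ler_pdivrMr.
near=> t.
have t1 : 1 <= t by near: t; apply: nbhs_pinfty_ge; exact: num_real.
have t0 : 0 <= t by apply: le_trans t1.
have te : e^-1 <= t by near: t; apply: nbhs_pinfty_ge; exact: num_real.
rewrite mulrCA ler_pM2l ?expR_gt0//.
have jk1 : t ^+ j.+1 <= t ^+ k by apply: ler_weXn2l.
apply: (@le_trans _ _ (e * t ^+ j.+1)); last by rewrite ler_pM2l.
rewrite exprS mulrA ler_peMl ?exprn_ge0// mulrC.
by rewrite -ler_pdivrMr// div1r.
Unshelve. all: by end_near. Qed.

(** Among the terms with nonzero coefficient, one has largest exponent in
    the lexicographic order on [(Re a, j)]; for large [t] its modulus exceeds
    the sum of those of all other terms. *)
Lemma exp_mono_indep n (a : nat -> R[i]) (j : nat -> nat) (c : nat -> R[i]) :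
  (forall s t, (s < n)%N -> (t < n)%N ->
    complex.Re (a s) = complex.Re (a t) -> j s = j t -> s = t) ->
  (forall T : R, exists2 t, T <= t & \sum_(s < n) c s * exp_mono (a s) (j s) t = 0) ->
  forall s, (s < n)%N -> c s = 0.
Proof.
move=> aj ex s sn; apply/eqP/negPn/negP => cs0.
pose s0 := Ordinal sn.
have cs0' : c s0 != 0 by [].
pose F (i : 'I_n) := complex.Re (a i).
case: (@Order.TotalTheory.arg_maxP _ _ _ s0
  (fun i : 'I_n => c i != 0) F cs0') => s1 cs1 max1.
pose Q (i : 'I_n) := (c i != 0) && (F i == F s1).
have Qs1 : Q s1 by rewrite /Q cs1 eqxx.
case: (@arg_maxnP _ s1 Q (fun i : 'I_n => j i) Qs1) => m /andP[cm /eqP Fm] max2.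
pose G := \sum_(i < n) cnorm (c i).
have G0 : 0 < G.
  rewrite /G (bigD1 m)//= ltr_pwDl ?cnorm_gt0//.
  by apply: sumr_ge0 => i _; exact: cnorm_ge0.
(* With this ratio all other terms add up to at most half of the term [m]. *)
pose e := cnorm (c m) / (G *+ 2).
have e0 : 0 < e by rewrite divr_gt0 ?cnorm_gt0// mulrn_wgt0.
have near_le (i : 'I_n) : \forall t \near +oo, i != m -> c i != 0 ->
    expR (F i * t) * t ^+ j i <= e * (expR (F m * t) * t ^+ j m).
  have [_|im] := eqVneq i m; first by apply: nearW.
  have [_|ci] := eqVneq (c i) 0; first by apply: nearW.
  have Fim : F i <= F m by rewrite Fm; apply: max1.
  move: Fim; rewrite le_eqVlt => /orP[/eqP Fi|Fi].
    have ji : (j i < j m)%N.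
      have jim : (j i <= j m)%N by apply: max2; rewrite /Q ci Fi Fm eqxx.
      rewrite ltn_neqAle jim andbT.
      apply: contra_neq im => ji; apply/val_inj.
      exact: (aj _ _ (ltn_ord i) (ltn_ord m) Fi ji).
    have H := exp_mono_dominated e0 (or_intror (conj Fi ji)).
    by near=> t => _ _; near: t; exact: H.
  have H := @exp_mono_dominated (F i) (F m) (j i) (j m) e e0 (or_introl Fi).
  by near=> t => _ _; near: t; exact: H.
have [M [_ HM]] := filter_forall _ near_le.
have [t tM sum0] := ex (Num.max 1 (M + 1)).
move: tM; rewrite ge_max => /andP[t1 tM].
have t_gt0 : 0 < t by apply: lt_le_trans t1.
have t0 := ltW t_gt0.
have {}HM := HM t (lt_le_trans (ltr_pwDr ltr01 (lexx M)) tM).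
pose E := expR (F m * t) * t ^+ j m.
have : cnorm (c m) * E <= e * G * E.
  move: sum0; rewrite (bigD1 m)//= => /eqP; rewrite addr_eq0 => /eqP sum0.
  have : `|c m * exp_mono (a m) (j m) t| <=
      \sum_(i < n | i != m) `|c i * exp_mono (a i) (j i) t|.
    by rewrite sum0 normrN; apply: ler_norm_sum.
  rewrite (eq_bigr (fun i : 'I_n =>
    (cnorm (c i * exp_mono (a i) (j i) t))%:C)); last first.
    by move=> i _; rewrite cnormE.
  rewrite cnormE -rmorph_sum lecR cnormM cnorm_exp_mono// => /le_trans; apply.
  rewrite /G [e * _]mulrC mulr_suml mulr_suml [leRHS](bigD1 m)//= ler_wpDl//.
    apply: mulr_ge0; first by rewrite mulr_ge0 ?cnorm_ge0 ?(ltW e0).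
    by rewrite mulr_ge0 ?expR_ge0 ?exprn_ge0.
  apply: ler_sum => i im; rewrite cnormM cnorm_exp_mono// -mulrA.
  have [->|ci] := eqVneq (c i) 0; first by rewrite /cnorm normr0 !mul0r.
  by rewrite ler_wpM2l ?cnorm_ge0// HM.
have -> : e * G = cnorm (c m) / 2 by rewrite /e; field; rewrite gt_eqF.
rewrite ler_pM2r; last by rewrite mulr_gt0 ?expR_gt0 ?exprn_gt0.
by have := cnorm_gt0 cm; lra.
Unshelve. all: by end_near. Qed.

End Growth.

(** * The valuation derivations *)

Section Assembly.
Context (R : realType).
Implicit Types (f g h : arith R).

Definition valuation_weight (p n : nat) : R[i] := (logn p n)%:R.

(** This is the convolution of [dprime p f] with the indicator function of [p];
    unlike [dprime p] it does not move the support, which makes leading terms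
    immediate to read. *)
Definition vder p f : arith R := wder (valuation_weight p) f.

Lemma valuation_additive p : additive_weight (valuation_weight p).
Proof. by move=> a b a0 b0; rewrite /valuation_weight lognM// natrD. Qed.

Lemma vder_derivation p : derivation (vder p).
Proof. exact: wder_derivation (valuation_additive p). Qed.

Lemma dprime_vder p f : prime p -> dprime p f = 0 -> vder p f = 0.
Proof.
move=> pp df; apply: arithP => n n0; rewrite arith0E wderE /valuation_weight.
have [pn|pn] := boolP (p %| n)%N; last first.
  by rewrite lognE (negPf pn) !andbF mul0r.
have := congr1 (fun f : arith R => f (n %/ p)%N) df.
rewrite arith0E mk_arithE ?divnK//.
by rewrite divn_gt0 ?prime_gt0// dvdn_leq.
Qed.

Lemma vder_eq0 p f : ~ primes_of (supp f) p -> vder p f = 0.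
Proof.
move=> nfp; apply: arithP => n n0; rewrite arith0E wderE /valuation_weight.
have [->|fn] := eqVneq (f n) 0; first by rewrite mulr0.
rewrite lognE; case: ifP => [/and3P[pp _ pn]|_]; last by rewrite mul0r.
by case: nfp; split=> //; exists n.
Qed.

(** * Linear independence of the twists *)

Definition twist (alpha : nat -> R[i]) f (ij : nat * nat) : arith R :=
  Tpow (alpha ij.1) (iter ij.2 (@dlog R) f).

Lemma twistE alpha f ij n :
  twist alpha f ij n = exp_mono (alpha ij.1) ij.2 (ln n%:R) * f n.
Proof.
case: (posnP n) => [->|n0]; first by rewrite !arith0 mulr0.
rewrite mk_arithE// /exp_mono -mulrA; congr (_ * _).
elim: ij.2 => [|j IH]; first by rewrite mul1r.
by rewrite iterS mk_arithE// IH exprS mulrA.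
Qed.

Lemma infinite_unbounded (P : set nat) N : infinite_set P -> exists2 p, P p & (N < p)%N.
Proof.
move=> infP; apply: contrapT => nP; apply: infP.
apply: (sub_finite_set _ (finite_II N.+1)) => p Pp /=.
by rewrite ltnS leqNgt; apply/negP => Np; apply: nP; exists p.
Qed.

(** Suppose some [c s] is nonzero, let [v] be the least point where one of them
    does not vanish and [m] the least multiple of [p] in the support of [f].
    At [v * m] the relation only involves leading terms, and reduces to a
    vanishing linear combination of exponential monomials at [ln m].  As
    [m >= p] and [P] is infinite, this happens for arbitrarily large [ln m]. *)
Lemma twist_indep alpha f (P : set nat) n (pi : nat -> nat * nat)
    (c : nat -> arith R) :
  (forall i j, complex.Re (alpha i) = complex.Re (alpha j) -> i = j) ->
  P `<=` primes_of (supp f) -> infinite_set P ->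
  (forall s t, (s < n)%N -> (t < n)%N -> pi s = pi t -> s = t) ->
  (forall p, P p -> \sum_(s < n) c s * vder p (twist alpha f (pi s)) = 0) ->
  forall s, (s < n)%N -> c s = 0.
Proof.
move=> alpha_Re Pf infP piI rel s sn; apply/eqP/negPn/negP => cs0.
have exv : exists v, [exists i : 'I_n, c i v != 0].
  have [v [_ cv _]] := arith_lead cs0.
  by exists v; apply/existsP; exists (Ordinal sn).
case: (ex_minnP exv) => v /existsP[s1 cs1] minv.
have v0 : (0 < v)%N by case: (v) cs1 => //; rewrite arith0 eqxx.
have clt (i : 'I_n) d : (d < v)%N -> c i d = 0.
  move=> dv; apply/eqP/negPn/negP => cid; move: dv; rewrite ltnNge => /negP; apply.
  by apply: minv; apply/existsP; exists i.
move/eqP: cs1; apply.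
apply: (@exp_mono_indep R n (fun i => alpha (pi i).1) (fun i => (pi i).2)
  (fun i => c i v)) => //.
  move=> i j ni nj /alpha_Re e1 e2; apply: piI => //.
  by rewrite [pi i]surjective_pairing [pi j]surjective_pairing e1 e2.
move=> T.
have [p Pp Tp] := infinite_unbounded (Num.truncn (expR T)) infP.
have [pp [m0 fm0 pm0]] := Pf _ Pp.
have exm : exists m, (f m != 0) && (p %| m)%N by exists m0; rewrite pm0 andbT.
case: (ex_minnP exm) => m /andP[fm pm] minm.
have m_gt0 : (0 < m)%N by case: (m) fm => //; rewrite arith0 eqxx.
exists (ln m%:R).
  rewrite -(expRK T) ler_ln ?posrE ?expR_gt0 ?ltr0n//.
  apply: ltW; rewrite -truncn_lt_nat ?expR_ge0//.
  by apply: leq_trans Tp _; apply: dvdn_leq.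
have vlt i e : (e < m)%N -> vder p (twist alpha f (pi i)) e = 0.
  move=> em; rewrite wderE twistE /valuation_weight.
  have [pe|pe] := boolP (p %| e)%N; last by rewrite lognE (negPf pe) !andbF mul0r.
  have [->|fe] := eqVneq (f e) 0; first by rewrite !mulr0.
  by move: em; rewrite ltnNge => /negP; case; apply: minm; rewrite fe.
have k0 : valuation_weight p m * f m != 0.
  rewrite mulf_neq0// /valuation_weight pnatr_eq0 -lt0n.
  by rewrite lognE pp m_gt0 pm.
apply: (mulIf k0); rewrite mul0r mulr_suml.
have := congr1 (fun f : arith R => f (v * m)%N) (rel _ Pp).
rewrite arith0E arith_sumE => rel0; rewrite -[RHS]rel0.
apply: eq_bigr => i _; rewrite arithM_lead//; [|exact: clt|exact: vlt].
by rewrite wderE twistE -[LHS]mulrA; congr (_ * _); rewrite mulrCA.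
Qed.

(** * Derivations separating the chains *)

Definition vspan (P : set nat) (v : seq (arith R * {p | P p})) f : arith R :=
  lincomb v (fun p => vder (sval p) f).

Lemma vspan_derivation P v : derivation (@vspan P v).
Proof.
split=> x y; rewrite /vspan /lincomb.
  rewrite -big_split; apply: eq_bigr => q _.
  by rewrite (vder_derivation _).1 mulrDr.
rewrite mulr_suml mulr_sumr -big_split; apply: eq_bigr => q _.
by rewrite (vder_derivation _).2 mulrDr mulrA mulrCA.
Qed.

Lemma vspan_Exp P v f : @vspan P v (Exp f) = Exp f * @vspan P v f.
Proof.
rewrite /vspan /lincomb mulr_sumr; apply: eq_bigr => q _.
by rewrite /vder wder_Exp 1?mulrCA//; exact: valuation_additive.
Qed.

Lemma vspan_iter_Exp P v f m : exists2 e, e != 0 &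
  @vspan P v (iter m (@Exp R) f) = e * @vspan P v f.
Proof.
elim: m => [|m [e e0 IH]]; first by exists 1; rewrite ?oner_neq0// mul1r.
exists (iter m.+1 (@Exp R) f * e); last by rewrite iterS vspan_Exp IH mulrA.
by apply: (dom_neq0 (@arith_dom R)) => //; exact: Exp_neq0.
Qed.

(** If every combination of the [vder p] killing the earlier twists killed the
    twist [s] too, this twist would depend linearly on the earlier ones,
    against [twist_indep]. *)
Lemma dual_derivation alpha f (P : set nat) (pi : nat -> nat * nat) s :
  (forall i j, complex.Re (alpha i) = complex.Re (alpha j) -> i = j) ->
  P `<=` primes_of (supp f) -> infinite_set P ->
  (forall t u, (t <= s)%N -> (u <= s)%N -> pi t = pi u -> t = u) ->
  exists v, (forall t, (t < s)%N -> @vspan P v (twist alpha f (pi t)) = 0) /\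
    @vspan P v (twist alpha f (pi s)) != 0.
Proof.
move=> alpha_Re Pf infP piI; apply: contrapT => nv.
pose l t (p : {p | P p}) := vder (sval p) (twist alpha f (pi t)).
have [v hv|c [a [c0 ca]]] := @common_kernel_dependent _ _ s l (l s) (@arith_dom R).
  apply/eqP/negPn/negP => vs; apply: nv; exists v; split=> //.
pose b t := if t == s then - c else a t.
have : b s = 0.
  apply: (@twist_indep alpha f P s.+1 pi b) => // p Pp.
  rewrite big_ord_recr /= /b eqxx mulNr.
  have := ca (exist _ p Pp); rewrite /l /= => ->; apply/eqP; rewrite subr_eq0.
  by apply/eqP; apply: eq_bigr => i _; rewrite (ltn_eqF (ltn_ord i)).
by rewrite /b eqxx => /eqP; rewrite oppr_eq0 (negPf c0).
Qed.

(** * Relations between iterated exponentials *)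

(** If the maximum in the definition of [kW] is not attained, [kW W] takes the
    default value 0, for which no logarithm is applied. *)
Lemma kW_defined (W : set (arith R)) g : W g -> Log_iter_defined (kW W) g.
Proof.
move=> Wg; rewrite /kW; case: xgetP => [k _ [Wk _]|_]; first exact: Wk.
by [].
Qed.

Lemma Exp_iter_from_Log k (m : int) g : Log_iter_defined k g -> - k%:Z <= m ->
  exists l, Exp_iter m g = iter l (@Exp R) (iter k (@Log R) g).
Proof.
move=> gk; case: m => m mk.
  exists (m + k)%N; rewrite iterD (iter_ExpLog gk)// subnn.
  by [].
exists (k - m.+1)%N; rewrite (iter_ExpLog gk) ?leq_subr//.
by rewrite subKn//; lia.
Qed.

(** The elements [x l] belong to the chains whose bases are the [k]-fold
    logarithms of finitely many twists.  Along a chain a derivation is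
    multiplied by nonzero factors, so one that kills the twist kills the base
    and conversely; [dual_derivation] therefore provides what
    [families_tower_transc] requires. *)
Lemma Exp_star_no_relation alpha f (P : set nat) n (x : 'I_n -> arith R)
    (p : mpoly n (arith R)) :
  (forall i j, complex.Re (alpha i) = complex.Re (alpha j) -> i = j) ->
  P `<=` primes_of (supp f) -> infinite_set P -> injective x ->
  (forall l, Exp_star [set g | exists i j : nat,
     g = Tpow (alpha i) (iter j (@dlog R) f)] (x l)) ->
  (forall m q, P q -> vder q (mcoeff m p) = 0) ->
  meval x p = 0 -> p = 0.
Proof.
move=> alpha_Re Pf infP xI Xx Kp px.
set W := [set g | _] in Xx; pose k := kW W.
have Wk ij : Log_iter_defined k (twist alpha f ij).
  by apply: kW_defined; exists ij.1, ij.2.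
pose base ij := iter k (@Log R) (twist alpha f ij).
have baseK ij : iter k (@Exp R) (base ij) = twist alpha f ij.
  by rewrite (iter_ExpLog (Wk ij))// subnn.
have /choice[code codeP] : forall l, exists c : nat * nat * nat,
    x l = iter c.2 (@Exp R) (base c.1).
  move=> l; have [g [m [[i [j gE]] mk xE]]] := Xx l.
  have [e eE] := Exp_iter_from_Log (Wk (i, j)) mk.
  by exists ((i, j), e); rewrite xE gE -[Tpow _ _]/(twist alpha f (i, j)) eE.
pose pairs := undup [seq (code l).1 | l : 'I_n].
pose pi := nth (0%N, 0%N) pairs.
pose M := \max_(l < n) (code l).2.
pose y s m := iter m (@Exp R) (base (pi s)).
pose K : set (arith R) := [set a | forall q, P q -> vder q a = 0].
have sK : subring K.
  split.
  - by move=> q _; apply: der1; exact: vder_derivation.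
  - move=> a b Ka Kb q Pq.
    by rewrite (vder_derivation q).1 (derN (vder_derivation q)) Ka// Kb// subrr.
  - move=> a b Ka Kb q Pq.
    by rewrite (vder_derivation q).2 Ka// Kb// mul0r mulr0 addr0.
have /choice[v vP] : forall s, exists v : seq (arith R * {p | P p}),
    (s < size pairs)%N ->
    (forall t, (t < s)%N -> vspan v (base (pi t)) = 0) /\
    vspan v (base (pi s)) != 0.
  move=> s; have [sn|//] := ltnP s (size pairs); last by exists [::].
  have [|v [v0 vs]] := @dual_derivation alpha f P pi s alpha_Re Pf infP.
    move=> t u ts us /eqP; rewrite nth_uniq ?undup_uniq//.
    - by move/eqP.
    - exact: leq_ltn_trans sn.
    - exact: leq_ltn_trans sn.
  exists v => _; split.
    move=> t ts; have := v0 t ts; rewrite -baseK.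
    have [e e0 ->] := vspan_iter_Exp v (base (pi t)) k.
    by move=> /(@arith_dom R)[e00|//]; move: e0; rewrite e00 eqxx.
  apply: contra_neq vs; rewrite -baseK.
  by have [e _ ->] := vspan_iter_Exp v (base (pi s)) k => ->; rewrite mulr0.
pose z j := y (j %/ M.+1)%N (j %% M.+1)%N.
have tz : forall j, (j < size pairs * M.+1)%N -> transc (tower K z j) (z j).
  apply: (families_tower_transc (D := fun s => vspan (v s))
    (@arith_dom R) (@arith_char0 R)).
  - move=> s sn; have [vt vs] := vP s sn; split.
    + exact: vspan_derivation.
    + move=> a Ka; rewrite /constants /= /vspan /lincomb big1// => -[b [q Pq]] _ /=.
      by rewrite Ka// mulr0.
    + exact: vs.
    + move=> t m ts; have [e _ ->] := vspan_iter_Exp (v s) (base (pi t)) m.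
      by rewrite vt// mulr0.
    + by move=> m; rewrite /y iterS vspan_Exp.
  - by move=> s m; rewrite /y iterS Exp_neq0.
(* The position of [x l] when the chains are listed one after the other. *)
pose kap l := (index (code l).1 pairs * M.+1 + (code l).2)%N.
have codeM l : ((code l).2 < M.+1)%N by rewrite ltnS /M (bigD1 l)//= leq_maxl.
have codei l : (code l).1 \in pairs.
  by rewrite mem_undup; apply/mapP; exists l; rewrite ?mem_enum.
have xz l : x l = z (kap l).
  rewrite /z /kap divnMDl// modnMDl divn_small// modn_small// addn0.
  by rewrite /y /pi nth_index// codeP.
apply: (tower_alg_indep (k := kap) sK tz _ _ xz _ px) => //.
- by move=> l l' kk; apply: xI; rewrite !xz kk.
- move=> l; rewrite /kap; have := codei l; rewrite -index_mem.
  by have := codeM l; nia.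
Qed.

End Assembly.

(** * Independence over kernels and over functions with finitely many primes *)

Theorem theorem5p5 (R : realType) (f : arith R) (alpha : nat -> R[i])
    (f_notin_S : ~ @Sfin R f)
    (alpha_Re : forall i j : nat,
      complex.Re (alpha i) = complex.Re (alpha j) -> i = j) :
  let X := Exp_star
    [set g : arith R | exists i j : nat, g = Tpow (alpha i) (iter j (@dlog R) f)] in
  (forall D : set (arith R -> arith R),
     D `<=` Delta f -> infinite_set D -> alg_indep (ker_der D) X) /\
  alg_indep (@Sfin R) X.
Proof.
move=> X; split.
  move=> D Df infD n x p xI Xx Kp px.
  pose P : set nat := [set q | primes_of (supp f) q /\ D (dprime q)].
  apply: (Exp_star_no_relation (P := P) alpha_Re _ _ xI Xx _ px).
  - by move=> q [].
  - move=> finP; apply: infD; apply: (sub_finite_set _ (finite_image (@dprime R) finP)).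
    by move=> d Dd; have [q fq dq] := Df d Dd; exists q => //; split=> //; rewrite dq.
  - by move=> m q [[pq _] Dq]; apply: dprime_vder => //; apply: Kp.
move=> n x p xI Xx Sp px.
(* Finitely many coefficients involve finitely many primes; the others still
   form an infinite subset of the primes of [f]. *)
pose F : set nat := \bigcup_(m in [set` msupp p]) primes_of (supp (mcoeff m p)).
pose P : set nat := primes_of (supp f) `\` F.
apply: (Exp_star_no_relation (P := P) alpha_Re _ _ xI Xx _ px).
- by move=> q [].
- apply: infinite_setD => //.
  by apply: bigcup_finite => // m _; exact: Sp.
- move=> m q [_ nF]; have [mp|/memN_msupp_eq0->] := boolP (m \in msupp p).
    by apply: vder_eq0 => mq; apply: nF; exists m.
  by apply: der0; exact: vder_derivation.
Qed.
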